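(* For any $c\in(-\sqrt2,\sqrt2)$, the following identities between differential operators on $\mathbb R$ hold: $$L_+=S_c^\star S_c\qquad\text{and}\qquad S_c(L_--c^2)S_c^\star=(\partial_x^2-\beta^2)\partial_x^2 .$$
   Context: For $c\in(-\sqrt2,\sqrt2)$, set $\beta=\sqrt{2-c^2}>0$, $R_c(x)=\frac{\beta}{\sqrt2}\tanh\left(\frac{\beta x}{2}\right)$ and $Q_c(x)=\sqrt2R_c'(x)=\frac{\beta^2}{2}\operatorname{sech}^2\left(\frac{\beta x}{2}\right)$. The operators are $$L_+=-\partial_x^2+\beta^2-3Q_c,\quad L_-=-\partial_x^2+c^2-Q_c,\quad S_c=\partial_x+\sqrt2R_c,\quad S_c^\star=-\partial_x+\sqrt2R_c,$$ where functions act by multiplication and products of operators are compositions (acting, e.g., on smooth functions). *)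

(* Defs.v *)
From Stdlib Require Import Reals.
From Coquelicot Require Import Coquelicot.
Open Scope R_scope.

Definition smooth (f : R -> R) : Prop := forall (n : nat) (x : R), ex_derive_n f n x.

(* Operators are total maps on all functions, because [Derive] is total; they
   have their analytic meaning on smooth functions, and are compared only there. *)
Definition op : Type := (R -> R) -> R -> R.

Definition op_eq (A B : op) : Prop :=
  forall f : R -> R, smooth f -> forall x : R, A f x = B f x.

Definition ddx : op := Derive.
Definition mul (g : R -> R) : op := fun f x => g x * f x.
Definition op_add (A B : op) : op := fun f x => A f x + B f x.
Definition op_opp (A : op) : op := fun f x => - A f x.
Definition op_sub (A B : op) : op := fun f x => A f x - B f x.
Definition op_comp (A B : op) : op := fun f => A (B f).

Declare Scope op_scope.
Delimit Scope op_scope with op.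
Bind Scope op_scope with op.
Notation "A + B" := (op_add A B) : op_scope.
Notation "- A" := (op_opp A) : op_scope.
Notation "A - B" := (op_sub A B) : op_scope.
(* The product of operators is composition. *)
Notation "A * B" := (op_comp A B) : op_scope.
Notation "A == B" := (op_eq A%op B%op) (at level 70, no associativity) : op_scope.

Definition beta (c : R) : R := sqrt (2 - c ^ 2).

Definition Rc (c x : R) : R := beta c / sqrt 2 * tanh (beta c * x / 2).

(* Q_c = sqrt 2 R_c', i.e. (beta^2 / 2) sech^2 (beta x / 2); see [Qc_sech]. *)
Definition Qc (c x : R) : R := sqrt 2 * Derive (Rc c) x.

Lemma Qc_sech (c x : R) :
  Qc c x = beta c ^ 2 / 2 * (/ cosh (beta c * x / 2)) ^ 2.
Proof.
  assert (Hc : forall y, cosh y <> 0).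
  { intros y; unfold cosh; pose proof (exp_pos y); pose proof (exp_pos (- y)).
    apply Rgt_not_eq; apply Rdiv_lt_0_compat; [apply Rplus_lt_0_compat|]; auto with real. }
  assert (H2 : sqrt 2 <> 0) by (apply Rgt_not_eq, sqrt_lt_R0; auto with real).
  assert (Ht : forall y, is_derive tanh y ((/ cosh y) ^ 2)).
  { intros y; pose proof (Hc y) as Hy; unfold cosh in Hy; unfold tanh, sinh, cosh.
    auto_derive; [exact Hy|].
    assert (Hs : exp y + exp (- y) <> 0)
      by (intros E; apply Hy; rewrite E; unfold Rdiv; ring).
    assert (Hp : exp y * exp (- y) = 1)
      by (rewrite <- exp_plus, Rplus_opp_r; apply exp_0).
    transitivity (4 * (exp y * exp (- y)) / (exp y + exp (- y)) ^ 2).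
    - field; exact Hs.
    - rewrite Hp; field; exact Hs. }
  unfold Qc, Rc.
  rewrite (is_derive_unique _ x
    (beta c / sqrt 2 * (beta c / 2 * (/ cosh (beta c * x / 2)) ^ 2))).
  - field; split; [apply Hc|exact H2].
  - apply (is_derive_scal (fun x => tanh (beta c * x / 2))).
    apply (is_derive_comp tanh (fun x => beta c * x / 2)); [apply Ht|].
    auto_derive; [exact I|field].
Qed.

Definition Lplus (c : R) : op :=
  (- (ddx * ddx) + mul (fun _ => (beta c ^ 2)%R) - mul (fun x => (3 * Qc c x)%R))%op.

Definition Lminus (c : R) : op :=
  (- (ddx * ddx) + mul (fun _ => (c ^ 2)%R) - mul (Qc c))%op.

Definition Sc (c : R) : op := (ddx + mul (fun x => (sqrt 2 * Rc c x)%R))%op.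

Definition Sc_star (c : R) : op := (- ddx + mul (fun x => (sqrt 2 * Rc c x)%R))%op.

(* Main.v *)
(* With W = sqrt 2 R_c = beta tanh (beta x / 2), everything follows from W' = Q_c
   and the Riccati relation W^2 + 2 Q_c = beta^2, hence Q_c' = - W Q_c.  The second
   identity is best computed from the inside out:
   (L_- - c^2) S_c^* f = f''' - W f'' - Q_c f', in which f itself has dropped out. *)
Require Import Defs.
From Stdlib Require Import Reals.
From Coquelicot Require Import Coquelicot.
Open Scope R_scope.

Lemma cosh_neq0 (y : R) : cosh y <> 0.
Proof.
  unfold cosh; pose proof (exp_pos y); pose proof (exp_pos (- y)).
  apply Rgt_not_eq, Rdiv_lt_0_compat; [apply Rplus_lt_0_compat|]; auto with real.
Qed.

Lemma tanh_sqr (y : R) : tanh y ^ 2 = 1 - (/ cosh y) ^ 2.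
Proof.
  pose proof (cosh_neq0 y) as Hc.
  assert (Hp : cosh y ^ 2 - sinh y ^ 2 = 1).
  { transitivity (exp y * exp (- y)); [unfold cosh, sinh; field|].
    rewrite <- exp_plus, Rplus_opp_r; apply exp_0. }
  transitivity ((cosh y ^ 2 - (cosh y ^ 2 - sinh y ^ 2)) / cosh y ^ 2);
    [unfold tanh|rewrite Hp]; field; exact Hc.
Qed.

Lemma sqrt2_neq0 : sqrt 2 <> 0.
Proof. apply Rgt_not_eq, sqrt_lt_R0; auto with real. Qed.

(** Since [Qc] is defined through [Derive (Rc c)], only differentiability of R_c is at stake, and
    that comes down to cosh having no zero. *)
Lemma is_derive_sqrt2_Rc (c x : R) :
  is_derive (fun y => sqrt 2 * Rc c y) x (Qc c x).
Proof.
  apply (is_derive_scal (Rc c)), Derive_correct.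
  unfold Rc, tanh, sinh, cosh; auto_derive.
  exact (cosh_neq0 (beta c * x / 2)).
Qed.

(** With W = beta tanh and 2 Q_c = beta^2 sech^2, this is tanh^2 + sech^2 = 1 scaled by beta^2. *)
Lemma Rc_riccati (c x : R) :
  (sqrt 2 * Rc c x) ^ 2 + 2 * Qc c x = beta c ^ 2.
Proof.
  rewrite Qc_sech; unfold Rc.
  replace (sqrt 2 * (beta c / sqrt 2 * tanh (beta c * x / 2)))
    with (beta c * tanh (beta c * x / 2)) by (field; apply sqrt2_neq0).
  rewrite Rpow_mult_distr, tanh_sqr; field; apply cosh_neq0.
Qed.

Lemma is_derive_Qc (c x : R) :
  is_derive (Qc c) x (- (sqrt 2 * Rc c x * Qc c x)).
Proof.
  pose proof (is_derive_sqrt2_Rc c x) as HW.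
  (* Solving the Riccati relation for Q_c leaves only W to differentiate. *)
  assert (HQ : forall y, (beta c ^ 2 - (sqrt 2 * Rc c y) ^ 2) / 2 = Qc c y)
    by (intros y; rewrite <- (Rc_riccati c y); field).
  apply (is_derive_ext _ _ _ _ HQ); clear HQ.
  set (W := fun y => sqrt 2 * Rc c y) in *.
  change (is_derive (fun y => (beta c ^ 2 - W y ^ 2) / 2) x (- (W x * Qc c x))).
  auto_derive; [now exists (Qc c x)|].
  replace (Derive _ x) with (Qc c x) by (symmetry; exact (is_derive_unique _ _ _ HW)).
  field.
Qed.

Lemma smooth_is_derive (f : R -> R) (n : nat) (x : R) :
  smooth f -> is_derive (Derive_n f n) x (Derive_n f (S n) x).
Proof. intros Hf; apply Derive_correct, (Hf (S n)). Qed.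

(** The first-order terms cancel, leaving the potential W^2 - W' = W^2 - Q_c, which is beta^2 - 3
    Q_c by Riccati. *)
Lemma Lplus_factor (c : R) : (Lplus c == Sc_star c * Sc c)%op.
Proof.
  intros f Hf x.
  unfold Lplus, Sc_star, Sc, op_comp, op_add, op_sub, op_opp, mul, ddx.
  assert (H : Derive (fun y => Derive f y + sqrt 2 * Rc c y * f y) x
              = Derive (Derive f) x + (Qc c x * f x + sqrt 2 * Rc c x * Derive f x)).
  { apply is_derive_unique, (is_derive_plus (V := R_NormedModule)).
    - exact (smooth_is_derive f 1 x Hf).
    - apply (is_derive_mult (fun y => sqrt 2 * Rc c y) f);
        [apply is_derive_sqrt2_Rc|exact (smooth_is_derive f 0 x Hf)|exact Rmult_comm]. }
  rewrite H, <- (Rc_riccati c x); ring.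
Qed.

(* [auto_derive] leaves derivatives of eta-expanded functions, on which
   [is_derive_unique] does not rewrite. *)
Lemma Derive_eta (f : R -> R) (x l : R) :
  is_derive f x l -> Derive (fun y => f y) x = l.
Proof. apply is_derive_unique. Qed.

(** The coefficient of f is (L_- - c^2) W = - W'' - Q_c W, which vanishes because W'' = Q_c' = - W
    Q_c. *)
Lemma Lminus_Sc_star (c : R) (f : R -> R) (x : R) : smooth f ->
  ((Lminus c - mul (fun _ => (c ^ 2)%R)) * Sc_star c)%op f x =
  Derive_n f 3 x - sqrt 2 * Rc c x * Derive_n f 2 x - Qc c x * Derive_n f 1 x.
Proof.
  intros Hf.
  set (W := fun y => sqrt 2 * Rc c y).
  assert (HW : forall y, is_derive W y (Qc c y)) by apply is_derive_sqrt2_Rc.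
  assert (HQ : forall y, is_derive (Qc c) y (- (W y * Qc c y))) by apply is_derive_Qc.
  assert (Hn : forall n y, is_derive (Derive_n f n) y (Derive_n f (S n) y))
    by (intros n y; apply smooth_is_derive, Hf).
  pose (f0 := Derive_n f 0); pose (f1 := Derive_n f 1); pose (f2 := Derive_n f 2).
  (* Needed at every y, since this derivative is differentiated once more. *)
  assert (H1 : forall y, Derive (fun z => - f1 z + W z * f0 z) y
                         = - f2 y + W y * f1 y + Qc c y * f0 y).
  { intros y; apply is_derive_unique; auto_derive.
    - repeat split; eexists; [apply (Hn 1%nat)|apply HW|apply (Hn 0%nat)].
    - rewrite (Derive_eta W _ _ (HW y)),
        (Derive_eta f0 _ _ (Hn 0%nat y)), (Derive_eta f1 _ _ (Hn 1%nat y)).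
      unfold f0, f1, f2; ring. }
  assert (H2 : Derive (fun z => - f2 z + W z * f1 z + Qc c z * f0 z) x
               = - Derive_n f 3 x + W x * f2 x + 2 * Qc c x * f1 x - W x * Qc c x * f0 x).
  { apply is_derive_unique; auto_derive.
    - repeat split; eexists;
        [apply (Hn 2%nat)|apply HW|apply (Hn 1%nat)|apply HQ|apply (Hn 0%nat)].
    - rewrite (Derive_eta W _ _ (HW x)), (Derive_eta (Qc c) _ _ (HQ x)),
        (Derive_eta f0 _ _ (Hn 0%nat x)), (Derive_eta f1 _ _ (Hn 1%nat x)),
        (Derive_eta f2 _ _ (Hn 2%nat x)).
      unfold f0, f1, f2; ring. }
  unfold Lminus, Sc_star, op_comp, op_add, op_sub, op_opp, mul, ddx.
  change (- Derive (Derive (fun z => - f1 z + W z * f0 z)) x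
          + c ^ 2 * (- f1 x + W x * f0 x) - Qc c x * (- f1 x + W x * f0 x)
          - c ^ 2 * (- f1 x + W x * f0 x)
          = Derive_n f 3 x - W x * f2 x - Qc c x * f1 x).
  rewrite (Derive_ext _ _ x H1), H2; ring.
Qed.

(** Apply d/dx + W to f''' - W f'' - Q_c f'. The f''' terms cancel, the f' coefficient - Q_c' - W
    Q_c is zero, and the f'' coefficient - 2 Q_c - W^2 is - beta^2 by Riccati. *)
Lemma Sc_Lminus_Sc_star (c : R) :
  (Sc c * (Lminus c - mul (fun _ => (c ^ 2)%R)) * Sc_star c
     == (ddx * ddx - mul (fun _ => (beta c ^ 2)%R)) * (ddx * ddx))%op.
Proof.
  intros f Hf x.
  set (W := fun y => sqrt 2 * Rc c y).
  assert (HW : is_derive W x (Qc c x)) by apply is_derive_sqrt2_Rc.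
  assert (HQ : is_derive (Qc c) x (- (W x * Qc c x))) by apply is_derive_Qc.
  assert (Hn : forall n, is_derive (Derive_n f n) x (Derive_n f (S n) x))
    by (intros n; apply smooth_is_derive, Hf).
  pose (f1 := Derive_n f 1); pose (f2 := Derive_n f 2); pose (f3 := Derive_n f 3).
  pose (h := ((Lminus c - mul (fun _ => (c ^ 2)%R)) * Sc_star c)%op f).
  assert (Hh : forall y, h y = f3 y - W y * f2 y - Qc c y * f1 y)
    by (intros y; apply Lminus_Sc_star, Hf).
  assert (H1 : Derive (fun z => f3 z - W z * f2 z - Qc c z * f1 z) x
               = Derive_n f 4 x - W x * f3 x - 2 * Qc c x * f2 x + W x * Qc c x * f1 x).
  { apply is_derive_unique; auto_derive.
    - repeat split; eexists;
        [apply (Hn 3%nat)|apply HW|apply (Hn 2%nat)|apply HQ|apply (Hn 1%nat)].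
    - rewrite (Derive_eta W _ _ HW), (Derive_eta (Qc c) _ _ HQ),
        (Derive_eta f1 _ _ (Hn 1%nat)), (Derive_eta f2 _ _ (Hn 2%nat)),
        (Derive_eta f3 _ _ (Hn 3%nat)).
      unfold f1, f2, f3; ring. }
  (* Composition of operators is associative by conversion, so the left side is [Sc c] applied to
     [h]. *)
  change (Derive h x + W x * h x = Derive_n f 4 x - beta c ^ 2 * f2 x).
  rewrite (Derive_ext _ _ x Hh), H1, Hh, <- (Rc_riccati c x).
  change (sqrt 2 * Rc c x) with (W x); ring.
Qed.

Theorem lemma2 (c : R) (hc : - sqrt 2 < c < sqrt 2) :
  (Lplus c == Sc_star c * Sc c)%op /\
  (Sc c * (Lminus c - mul (fun _ => (c ^ 2)%R)) * Sc_star c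
     == (ddx * ddx - mul (fun _ => (beta c ^ 2)%R)) * (ddx * ddx))%op.
Proof. exact (conj (Lplus_factor c) (Sc_Lminus_Sc_star c)). Qed.
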